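(* Let $1\le s\le d$. Natural data $\bar x$ is uniform on $\{-1,1\}^d$; an augmentation $x\sim\mathcal{A}(\bar x)$ multiplies coordinate $j$ of $\bar x$ by an independent $\tau_j\sim\mathrm{Unif}[\tfrac12,1]$ for $j=s+1,\dots,d$ and keeps the first $s$ coordinates. Let $p_{\mathrm{data}}$ be the distribution of $x$ and $p_{\mathrm{pos}}$ the distribution of $(x,x^+)$, two independent augmentations of a common $\bar x$. The downstream task is $m$-way classification with label $y:\mathcal{X}\to[m]$ such that $y(x)=y(x')$ whenever $x_{1:s}=x'_{1:s}$. For $\lambda>0$ let $\mathcal{L}_\lambda(f)=\mathbb{E}_{(x,x^+)\sim p_{\mathrm{pos}}}[\|f(x)-f(x^+)\|_2^2]+\lambda\|\mathbb{E}_{x\sim p_{\mathrm{data}}}[f(x)f(x)^\top]-\mathbb{I}\|_F^2$. (1) Let $k=2^s$ and $\mathcal{F}_{\mathrm{ReLU}}=\{x\mapsto\sigma(Ux+b):U\in\mathbb{R}^{k\times d},b\in\mathbb{R}^k\}$ with $\sigma$ the entrywise ReLU. Let $\lambda>0$ and $\hat f\in\arg\min_{f\in\mathcal{F}_{\mathrm{ReLU}}}\mathcal{L}_\lambda(f)$. Then there exists $W\in\mathbb{R}^{m\times k}$ with $\mathbb{E}_{x\sim p_{\mathrm{data}}}[\|W\hat f(x)-e_{y(x)}\|_2^2]=0$. (2) Let $\mathcal{F}_{\mathrm{uni}}$ be the class of all functions $\mathbb{R}^d\to\mathbb{R}^k$. If $k\le2^{d-s}$, there exists $\hat f'\in\arg\min_{f\in\mathcal{F}_{\mathrm{uni}}}\mathcal{L}_\lambda(f)$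 such that every $W\in\mathbb{R}^{m\times k}$ satisfies $\mathbb{E}_{x\sim p_{\mathrm{data}}}[\|W\hat f'(x)-e_{y(x)}\|_2^2]\ge\frac12$.
   Context: $e_j\in\mathbb{R}^m$ denotes the $j$-th standard basis vector. *)

(* Defs.v *)
From HB Require Import structures.
From mathcomp Require Import all_boot all_order all_algebra.
From mathcomp Require Import all_classical all_reals all_analysis.
Set Implicit Arguments. Unset Strict Implicit. Unset Printing Implicit Defensive.
Import Order.TTheory GRing.Theory Num.Theory.
Local Open Scope classical_set_scope.
Local Open Scope ring_scope.

Lemma half_lt1 (R : realType) : (2%:R^-1 : R) < 1.
Proof. by rewrite invf_lt1 // ltr1n. Qed.

(** Mutual independence of a finite family of real random variables:
    each is measurable and the product rule holds for every choice of
    Borel sets (taking B i = setT recovers every subfamily). *)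
Definition mutually_independent {dT} {T : measurableType dT} {R : realType}
    (P : probability T R) (I : finType) (X : I -> T -> R) : Prop :=
  (forall i, measurable_fun setT (X i)) /\
  forall B : I -> set R, (forall i, measurable (B i)) ->
    P (\bigcap_(i in [set: I]) (X i @^-1` B i)) =
    (\prod_(i <- enum I) P (X i @^-1` B i))%E.

(** The augmented sample: first s coordinates of xbar kept,
    coordinate j >= s multiplied by tau_j. (0-based indices: j < s means
    coordinates 1..s of the paper.) *)
Definition augment {dT} {T : measurableType dT} {R : realType} (d s : nat)
    (xb tau : 'I_d -> T -> R) (w : T) : 'cV[R]_d :=
  \col_j (if (j < s)%N then xb j w else tau j w * xb j w).

Definition sqnorm {R : realType} (n : nat) (v : 'cV[R]_n) : R :=
  \sum_(i < n) (v i 0) ^+ 2.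

(** Real-valued expectation (used only on integrable quantities). *)
Definition Ereal {dT} {T : measurableType dT} {R : realType}
    (P : probability T R) (X : T -> R) : R := fine ('E_P[X])%E.

Definition contrastive_loss {dT} {T : measurableType dT} {R : realType}
    (P : probability T R) (d k : nat) (x xp : T -> 'cV[R]_d) (lam : R)
    (f : 'cV[R]_d -> 'cV[R]_k) : R :=
  Ereal P (fun w => sqnorm (f (x w) - f (xp w)))
  + lam * \sum_(i < k) \sum_(j < k)
      (Ereal P (fun w => f (x w) i 0 * f (x w) j 0) - (i == j)%:R) ^+ 2.

(** Functions for which the loss is well defined: f(x), f(x+) are random
    vectors with finite second moments. *)
Definition admissible {dT} {T : measurableType dT} {R : realType}
    (P : probability T R) (d k : nat) (x xp : T -> 'cV[R]_d)
    (f : 'cV[R]_d -> 'cV[R]_k) : Prop :=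
  forall i : 'I_k,
    measurable_fun setT (fun w => f (x w) i 0) /\
    measurable_fun setT (fun w => f (xp w) i 0) /\
    P.-integrable setT (fun w => ((f (x w) i 0) ^+ 2)%:E) /\
    P.-integrable setT (fun w => ((f (xp w) i 0) ^+ 2)%:E).

Definition relu {R : realType} (r : R) : R := Num.max r 0.

Definition relu_net {R : realType} (d k : nat) (U : 'M[R]_(k, d)) (b : 'cV[R]_k)
    (z : 'cV[R]_d) : 'cV[R]_k := map_mx relu (U *m z + b).

Definition downstream_error {dT} {T : measurableType dT} {R : realType}
    (P : probability T R) (d k m : nat) (x : T -> 'cV[R]_d)
    (y : 'cV[R]_d -> 'I_m) (W : 'M[R]_(m, k)) (f : 'cV[R]_d -> 'cV[R]_k)
    : \bar R :=
  ('E_P[(fun w => sqnorm (W *m f (x w) - delta_mx (y (x w)) (ord0 : 'I_1)))])%E.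

(* Main.v *)
Require Import Defs.
From HB Require Import structures.
From mathcomp Require Import all_boot all_order all_algebra.
From mathcomp Require Import ring lra zify.
From mathcomp Require Import all_classical all_reals all_analysis.
From mathcomp Require Import measurable_realfun.
Import Order.TTheory GRing.Theory Num.Theory.
Local Open Scope classical_set_scope.
Local Open Scope ring_scope.

(** The loss is nonnegative. In the ReLU class the value 0 is attained: neuron [a] detects the sign
    pattern [a] of the first [s] coordinates. So a minimizer agrees almost surely on positive pairs
    and has identity second moment. Agreement, continuity of the network and positivity of the law
    near each point of the support make every neuron constant on each fibre; a neuron that reads an
    augmented coordinate is then inactive, against its second moment 1. Hence the network is a
    function of the first [s] signs, its value table [M] is square with [M M^T = 2^s I], and
    [W = Y M^-1] fits any label table [Y]. Among all functions, the scaled indicators of [k] of the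
    [2^d] full sign patterns also reach loss 0, but vanish on all other patterns, which have
    probability [1 - k / 2^d >= 1/2]; there every linear probe has error 1. *)

(** * Signs, and the uniform law on segments of [1/2, 1] *)

Definition signb {R : realType} (b : bool) : R := if b then 1 else -1.

Lemma signb_sqr {R : realType} (b : bool) : signb b * signb b = 1 :> R.
Proof. by case: b; rewrite /signb ?mulrNN mulr1. Qed.

Lemma signb_eq {R : realType} (a b : bool) : (signb a == signb b :> R) = (a == b).
Proof.
have h : (1 == -1 :> R) = false by apply: gt_eqF; lra.
by case: a; case: b; rewrite /signb ?eqxx // eq_sym.
Qed.

Lemma uniform_prob_segment (R : realType) (u v : R) :
  2%:R^-1 <= u -> u < v -> v <= 1 ->
  uniform_prob (half_lt1 R) `[u, v] = (2 * (v - u))%:E.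
Proof.
move=> hu uv hv; rewrite /uniform_prob.
rewrite (eq_integral (cst 2%:E)); last first.
  move=> t; rewrite inE /= in_itv /= => /andP[ut tv].
  rewrite /uniform_pdf ifT; last by apply/andP; split; lra.
  by rewrite /cst; congr (_%:E); field.
rewrite integral_cst //= lebesgue_measure_itv /= lte_fin uv.
by rewrite -EFinB -EFinM.
Qed.

(** * Almost sure events and real-valued expectations *)

Section AlmostSure.
Context {dT} {T : measurableType dT} {R : realType} (P : probability T R).

Lemma probability1_ae (A : set T) : measurable A -> P A = 1%E ->
  {ae P, forall w, A w}.
Proof.
move=> mA PA; exists (~` A); split; first exact: measurableC.
  by rewrite probability_setC // PA subee.
by move=> w.
Qed.

(** Without such a point, [B] would lie inside the null set that carries the failure of [A]. This is
    how almost sure facts get evaluated at concrete samples. *)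
Lemma ae_event_exists (A B : set T) : measurable B -> (0 < P B)%E ->
  {ae P, forall w, A w} -> exists w, A w /\ B w.
Proof.
move=> mB PB [N [mN PN AN]]; apply: contrapT => nE.
have BN : B `<=` N.
  by move=> w Bw; apply: AN => Aw; apply: nE; exists w.
have := le_measure P (mem_set mB) (mem_set mN) BN.
by rewrite [X in (_ <= X)%E -> _]PN leNgt PB.
Qed.

(** [Ereal] goes through [fine], which sends an infinite expectation to 0. The almost sure bound
    makes the integral finite, so that a zero value is a genuine one and forces the nonnegative
    integrand to vanish almost surely. *)
Lemma ae_bounded_Ereal_eq0 (f : T -> R) (C : R) :
  measurable_fun setT f -> (forall w, 0 <= f w) ->
  {ae P, forall w, f w <= C} -> Ereal P f = 0 -> {ae P, forall w, f w = 0}.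
Proof.
move=> mf f0 fC; rewrite /Ereal unlock => fE.
have mEf : measurable_fun setT (EFin \o f) by exact/measurable_EFinP.
have C0 : 0 <= Num.max C 0 by rewrite le_max lexx orbT.
have If : (\int[P]_w (f w)%:E <= (Num.max C 0)%:E)%E.
  have -> : (Num.max C 0)%:E = (\int[P]_w (cst (Num.max C 0)%:E w))%E.
    by rewrite integral_cst //= probability_setT mule1.
  apply: ae_ge0_le_integral => //.
  - by move=> w _; rewrite lee_fin.
  - apply: (filterS _ fC) => w fw _.
    by rewrite lee_fin le_max fw.
have If0 : (\int[P]_w (f w)%:E = 0)%E.
  rewrite -[LHS]fineK ?fE //.
  by rewrite ge0_fin_numE ?(le_lt_trans If) ?ltry // integral_ge0 // => w _; rewrite lee_fin.
have /ae_eq_integral_abs : (\int[P]_w `|(EFin \o f) w| = 0)%E.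
  rewrite -[RHS]If0; apply: eq_integral => w _ /=.
  by rewrite ger0_norm.
case/(_ measurableT mEf) => N [mN PN fN].
exists N; split=> // w fw; apply: fN => /= /(_ I) [fw0].
exact: fw.
Qed.

Lemma Ereal_ge0 (f : T -> R) : (forall w, 0 <= f w) -> 0 <= Ereal P f.
Proof. by move=> f0; rewrite /Ereal fine_ge0 // expectation_ge0. Qed.

Lemma eq_Ereal_ae (f g : T -> R) : measurable_fun setT f -> measurable_fun setT g ->
  {ae P, forall w, f w = g w} -> Ereal P f = Ereal P g.
Proof.
move=> mf mg fg; rewrite /Ereal unlock; congr fine.
apply: ae_eq_integral => //; try exact/measurable_EFinP.
by apply: filterS fg => w -> _.
Qed.

End AlmostSure.

Lemma sqnorm_ge0 {R : realType} (n : nat) (v : 'cV[R]_n) : 0 <= sqnorm v.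
Proof. by apply: sumr_ge0 => i _; apply: sqr_ge0. Qed.

(** * The ReLU and the Lipschitz bound for one-layer networks *)

Section ReluNetworks.
Context {R : realType}.

Lemma relu_lipschitz (r r' : R) : `|relu r - relu r'| <= `|r - r'|.
Proof.
rewrite /relu; case: (leP r 0) => h; case: (leP r' 0) => h';
  rewrite ?subrr ?normr0 ?normr_ge0 // ?subr0 ?sub0r ?normrN.
- by rewrite gtr0_norm // ltr0_norm; lra.
- by rewrite !gtr0_norm; lra.
Qed.

(** The ReLU is injective on the positive half-line and positive only there, so two distinct inputs
    can collide only at output 0. *)
Lemma relu_eq (r r' : R) : relu r = relu r' -> r <> r' -> relu r = 0.
Proof. by rewrite /relu; case: (leP r 0) => h; case: (leP r' 0) => h' //; lra. Qed.

Context {k d : nat} (U : 'M[R]_(k, d)) (b : 'cV[R]_k).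

Lemma relu_netE (z : 'cV[R]_d) i : relu_net U b z i 0 = relu (\sum_j U i j * z j 0 + b i 0).
Proof. by rewrite !mxE. Qed.

(** The constant is the l1 norm of row [i], dual to the sup norm on inputs. It serves both for
    continuity near support points and for boundedness of the gap between two views. *)
Lemma relu_net_lipschitz (z z' : 'cV[R]_d) i (e : R) : (forall j, `|z j 0 - z' j 0| <= e) ->
  `|relu_net U b z i 0 - relu_net U b z' i 0| <= (\sum_j `|U i j|) * e.
Proof.
move=> ze; rewrite !relu_netE; apply: (le_trans (relu_lipschitz _ _)).
rewrite opprD addrACA subrr addr0 -sumrB; apply: (le_trans (ler_norm_sum _ _ _)).
rewrite mulr_suml; apply: ler_sum => j _.
by rewrite -mulrBr normrM ler_wpM2l.
Qed.

End ReluNetworks.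

(** * Finite sums and the enumeration of sign patterns *)

Lemma sqnorm0 {R : realType} (n : nat) : sqnorm (0 : 'cV[R]_n) = 0.
Proof. by rewrite /sqnorm big1 // => i _; rewrite mxE expr0n. Qed.

(** One disagreeing coordinate contributes -1 and the others at most 1 each. The bound [q - 1] is
    the threshold at which a detector neuron switches off. *)
Lemma sum_signb_lt {R : realType} (q : nat) (a b : {ffun 'I_q -> bool}) : a != b ->
  \sum_j signb (a j) * signb (b j) <= q%:R - 1 :> R.
Proof.
move=> ab; have [j abj] : exists j, a j != b j.
  apply/existsP; apply: contra_neqT ab; rewrite negb_exists => /forallP h.
  by apply/ffunP => j; apply/eqP; have := h j; rewrite negbK.
have -> : q%:R = \sum_(l < q) 1 :> R by rewrite sumr_const card_ord.
rewrite (bigD1 j) //= [X in _ <= X - _](bigD1 j) //=.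
have h1 : signb (a j) * signb (b j) = -1 :> R.
  by move: abj; case: (a j); case: (b j) => // _; rewrite /signb ?mul1r ?mulr1.
have h2 : \sum_(l < q | l != j) signb (a l) * signb (b l) <= \sum_(l < q | l != j) 1 :> R.
  by apply: ler_sum => l _; case: (a l); case: (b l); rewrite /signb ?mulrNN ?mulr1 ?mul1r; lra.
lra.
Qed.

Lemma sum_ord_narrow (V : nmodType) (s d : nat) (hsd : (s <= d)%N) (F : 'I_d -> V) :
  (forall j : 'I_d, (s <= j)%N -> F j = 0) ->
  \sum_j F j = \sum_(j < s) F (widen_ord hsd j).
Proof.
move=> F0; rewrite (bigID (fun j : 'I_d => (j < s)%N)) /= addrC big1 ?add0r.
  by rewrite (big_ord_narrow hsd).
by move=> j; rewrite -leqNgt; exact: F0.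
Qed.

Lemma card_sign_patterns (q : nat) : #|{ffun 'I_q -> bool}| = (2 ^ q)%N.
Proof. by rewrite card_ffun card_bool card_ord. Qed.

(** Serves both halves: for [k = 2 ^ q] it is a bijection that indexes the detector neurons, for
    smaller [k] it selects the patterns that receive a code word. *)
Definition sign_pattern {q k : nat} (h : (k <= 2 ^ q)%N) (i : 'I_k) : {ffun 'I_q -> bool} :=
  enum_val (cast_ord (esym (card_sign_patterns q)) (widen_ord h i)).

Lemma sign_pattern_inj {q k : nat} (h : (k <= 2 ^ q)%N) : injective (sign_pattern h).
Proof.
move=> i j /enum_val_inj /cast_ord_inj /(congr1 val) ij; exact: val_inj.
Qed.

Lemma sum_sign_pattern (V : nmodType) (q : nat) (F : {ffun 'I_q -> bool} -> V) :
  \sum_a F a = \sum_i F (sign_pattern (leqnn (2 ^ q)) i).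
Proof.
have inj := sign_pattern_inj (leqnn (2 ^ q)).
rewrite [LHS](reindex (sign_pattern (leqnn (2 ^ q)))) //.
apply: onW_bij; apply: (inj_card_bij inj).
by rewrite card_sign_patterns card_ord.
Qed.

(** Indicators of distinct patterns have disjoint supports, and the factor [sqrt (2 ^ q)] offsets
    the mass [2 ^ -q] of one pattern. This is the identity second moment of both zero-loss
    constructions. *)
Lemma sum_indicator_orthogonal {R : realType} (q k : nat) (h : (k <= 2 ^ q)%N) (i j : 'I_k) :
  (2 ^+ q)^-1 * \sum_a (Num.sqrt (2 ^+ q) * (sign_pattern h i == a)%:R) *
    (Num.sqrt (2 ^+ q) * (sign_pattern h j == a)%:R) = (i == j)%:R :> R.
Proof.
rewrite (bigD1 (sign_pattern h i)) //= big1 ?addr0; last first.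
  by move=> a; rewrite eq_sym => /negbTE->; rewrite mulr0 mul0r.
rewrite eqxx (inj_eq (sign_pattern_inj h)) eq_sym mulr1 mulrA -expr2 sqr_sqrtr ?exprn_ge0 //.
by rewrite mulrA mulVf ?mul1r // expf_neq0 // pnatr_eq0.
Qed.

(** * The sampling model: independent signs and multipliers *)

Section Sampling.
Context {R : realType} {d : nat} {dT : measure_display} {T : measurableType dT}.
Context {P : probability T R} {xb tau tau' : 'I_d -> T -> R}.
Hypothesis hxb_val : forall j w, xb j w = 1 \/ xb j w = -1.
Hypothesis hxb_law : forall j, P (xb j @^-1` [set 1]) = (2%:R^-1)%:E.
Hypothesis htau_law : forall j B, measurable B ->
  P (tau j @^-1` B) = uniform_prob (half_lt1 R) B.
Hypothesis htau'_law : forall j B, measurable B ->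
  P (tau' j @^-1` B) = uniform_prob (half_lt1 R) B.
Hypothesis hindep : mutually_independent P
  (fun i : ('I_d + ('I_d + 'I_d))%type =>
     match i with
     | inl j => xb j
     | inr (inl j) => tau j
     | inr (inr j) => tau' j
     end).

Lemma measurable_xb j : measurable_fun setT (xb j).
Proof. exact: (hindep.1 (inl j)). Qed.

Lemma measurable_tau j : measurable_fun setT (tau j).
Proof. exact: (hindep.1 (inr (inl j))). Qed.

Lemma measurable_tau' j : measurable_fun setT (tau' j).
Proof. exact: (hindep.1 (inr (inr j))). Qed.

Lemma xb_signb_law j b : P (xb j @^-1` [set signb b]) = (2%:R^-1)%:E.
Proof.
case: b; first exact: hxb_law.
have m1 : measurable (xb j @^-1` [set 1]).
  by rewrite -[X in measurable X]setTI; apply: measurable_xb.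
have -> : xb j @^-1` [set signb false] = ~` (xb j @^-1` [set 1]).
  apply/seteqP; split=> w /=; rewrite /signb.
    by move=> ->; lra.
  by case: (hxb_val j w).
rewrite probability_setC // hxb_law -EFinB.
by congr (_%:E); field.
Qed.

Lemma joint_event (A B C : 'I_d -> set R) :
  (forall j, measurable (A j)) -> (forall j, measurable (B j)) ->
  (forall j, measurable (C j)) ->
  let E := [set w | forall j, [/\ A j (xb j w), B j (tau j w) & C j (tau' j w)]] in
  measurable E /\
  P E = ((\prod_j P (xb j @^-1` A j)) *
    ((\prod_j P (tau j @^-1` B j)) * (\prod_j P (tau' j @^-1` C j))))%E.
Proof.
move=> mA mB mC E.
pose D (i : ('I_d + ('I_d + 'I_d))%type) := match i with
     | inl j => A j | inr (inl j) => B j | inr (inr j) => C j end.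
have mD i : measurable (D i) by case: i => [j|[j|j]] /=.
have := hindep.2 D mD.
set E' := (\bigcap_(i in _) _ : set T).
have EE' : E' = E.
  apply/seteqP; split=> w /= Hw.
    by move=> j; split; [exact: (Hw (inl j))|exact: (Hw (inr (inl j)))
      |exact: (Hw (inr (inr j)))].
  by case=> [j|[j|j]] _; case: (Hw j).
rewrite EE' => PE; split.
  rewrite -EE'; apply: fin_bigcap_measurable; first exact: finite_finset.
  move=> i _; rewrite -[X in measurable X]setTI.
  by case: i => [j|[j|j]]; [exact: measurable_xb|exact: measurable_tau|exact: measurable_tau'].
by rewrite PE big_enum /= !big_sumType /=.
Qed.

Lemma tau_box_ae : {ae P, forall w, forall j : 'I_d,
  (2%:R^-1 <= tau j w <= 1) && (2%:R^-1 <= tau' j w <= 1)}.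
Proof.
apply: filter_forall => j.
have H (t : 'I_d -> T -> R) : measurable_fun setT (t j) ->
    (forall B, measurable B -> P (t j @^-1` B) = uniform_prob (half_lt1 R) B) ->
    {ae P, forall w, 2%:R^-1 <= t j w <= 1}.
  move=> mt ht.
  have mS : measurable (t j @^-1` `[2%:R^-1, 1]).
    by rewrite -[X in measurable X]setTI; apply: mt.
  apply: (filterS _ (probability1_ae P _ mS _)) => [w|].
    by rewrite /= in_itv.
  rewrite ht // uniform_prob_segment ?half_lt1 //.
  by congr (_%:E); field.
by apply: (filterS _ (filterI (H _ (measurable_tau j) (htau_law j))
  (H _ (measurable_tau' j) (htau'_law j)))) => w /= [-> ->].
Qed.

(* Every point of the support of [(xbar, tau, tau')] is approached with positive probability. *)
Lemma sample_near (A : set T) (a : 'I_d -> bool) (t t' : 'I_d -> R) (e : R) :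
  {ae P, forall w, A w} -> 0 < e ->
  (forall j, 2%:R^-1 <= t j <= 1) -> (forall j, 2%:R^-1 <= t' j <= 1) ->
  exists w, A w /\ forall j,
    [/\ xb j w = signb (a j), `|tau j w - t j| <= e & `|tau' j w - t' j| <= e].
Proof.
move=> HA e0 ht ht'.
(* The window of radius [e] around [r] is clipped to [1/2, 1]; it keeps positive length even when
   [r] is an endpoint. *)
pose u (r : R) := Num.max 2%:R^-1 (r - e).
pose v (r : R) := Num.min 1 (r + e).
have uv r : 2%:R^-1 <= r <= 1 -> [/\ 2%:R^-1 <= u r, u r < v r & v r <= 1].
  move=> /andP[r1 r2]; rewrite /u /v; split.
  - by rewrite le_max lexx.
  - by rewrite gt_max !lt_min half_lt1 /=; apply/and3P; split; lra.
  - by rewrite ge_min lexx.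
have [mE PE] := @joint_event (fun j => [set signb (a j)]) (fun j => `[u (t j), v (t j)]%classic)
  (fun j => `[u (t' j), v (t' j)]%classic) (fun j => measurable_set1 _)
  (fun j => measurable_itv _) (fun j => measurable_itv _).
have prod_gt0 (F : 'I_d -> \bar R) : (forall j, 0 < F j)%E -> (0 < \prod_j F j)%E.
  by move=> F0; elim/big_ind: _ => // x y; exact: mule_gt0.
have [|w [Aw Bw]] := ae_event_exists _ A _ mE _ HA.
  rewrite PE !mule_gt0 //; apply: prod_gt0 => j.
  - by rewrite xb_signb_law lte_fin invr_gt0.
  - have [u1 u2 u3] := uv _ (ht j).
    by rewrite htau_law // uniform_prob_segment // lte_fin mulr_gt0 // subr_gt0.
  - have [u1 u2 u3] := uv _ (ht' j).
    by rewrite htau'_law // uniform_prob_segment // lte_fin mulr_gt0 // subr_gt0.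
exists w; split=> // j; have [xa] := Bw j.
rewrite /= !in_itv /= /u /v !ge_max !le_min => /andP[/andP[_ b1] /andP[_ b2]].
move=> /andP[/andP[_ b3] /andP[_ b4]].
by split=> //; rewrite ler_norml; apply/andP; split; lra.
Qed.

(** * The law of the first [q] signs *)

Section Pattern.
Context {q : nat} (hq : (q <= d)%N).

Definition pattern (w : T) : {ffun 'I_q -> bool} :=
  [ffun j => xb (widen_ord hq j) w == 1].

Lemma xb_pattern w (j : 'I_q) : xb (widen_ord hq j) w = signb (pattern w j).
Proof.
rewrite ffunE /signb; case: eqP => // h.
by case: (hxb_val (widen_ord hq j) w).
Qed.

Lemma pattern_eq a w :
  pattern w = a <-> forall j, xb (widen_ord hq j) w = signb (a j).
Proof.
split=> [<- j|h]; first exact: xb_pattern.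
by apply/ffunP => j; apply/eqP; rewrite -(@signb_eq R) -xb_pattern h.
Qed.

Lemma pattern_law (a : {ffun 'I_q -> bool}) :
  measurable (pattern @^-1` [set a]) /\
  P (pattern @^-1` [set a]) = ((2 ^+ q)^-1)%:E.
Proof.
(* [insub] succeeds exactly on indices below [q]; the remaining coordinates are unconstrained and
   contribute a factor 1. *)
pose A (j : 'I_d) : set R :=
  if insub (val j) : option 'I_q is Some i then [set signb (a i)] else setT.
have mA j : measurable (A j).
  by rewrite /A; case: insubP => // i _ _; exact: measurable_set1.
have [mE PE] := @joint_event A (fun=> setT) (fun=> setT) mA
  (fun=> measurableT) (fun=> measurableT).
have <- : [set w | forall j, [/\ A j (xb j w), setT (tau j w) & setT (tau' j w)]]
    = pattern @^-1` [set a].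
  apply/seteqP; split=> w /=.
    move=> h; apply/pattern_eq => j; have [+ _ _] := h (widen_ord hq j).
    rewrite /A; case: insubP => [i _ ij|]; last by rewrite /= ltn_ord.
    by rewrite /= (val_inj ij : i = j).
  move=> /pattern_eq h j; split=> //; rewrite /A; case: insubP => // i ij E /=.
  by rewrite -h; congr (xb _ w); exact: val_inj.
have P1 (t : 'I_d -> T -> R) : (\prod_j P (t j @^-1` setT) = 1)%E.
  by rewrite big1 // => j _; rewrite preimage_setT probability_setT.
split=> //; rewrite PE !P1 !mule1.
transitivity (\prod_(j < d) (if (j < q)%N then 2%:R^-1 else 1 : R)%:E)%E.
  apply: eq_bigr => j _; rewrite /A; case: insubP => [i -> _|/negbTE->].
    exact: xb_signb_law.
  by rewrite preimage_setT probability_setT.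
rewrite prodEFin; congr (_%:E).
rewrite -big_mkcond /= (big_ord_narrow hq) /=.
by rewrite prodr_const card_ord exprVn.
Qed.

(** The pattern is uniform on its [2 ^ q] values, so the expectation is a plain average.
    Nonnegativity of [G] lets the integral pass through the expansion in indicators. *)
Lemma expectation_pattern (G : {ffun 'I_q -> bool} -> R) : (forall a, 0 <= G a) ->
  ('E_P[fun w => G (pattern w)] = ((2 ^+ q)^-1 * \sum_a G a)%:E)%E.
Proof.
move=> G0; rewrite unlock.
rewrite (eq_integral (fun w => \sum_a ((G a)%:E * (\1_(pattern @^-1` [set a]) w)%:E)%E)); last first.
  move=> w _; rewrite (bigD1 (pattern w)) //= big1 ?adde0.
    by rewrite indicE mem_set // mule1.
  by move=> a aw; rewrite indicE memNset ?mule0 //= => E; rewrite E eqxx in aw.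
rewrite ge0_integral_sum //; last 2 first.
- move=> a; apply: measurable_funeM; apply/measurable_EFinP.
  exact: measurable_indic (pattern_law a).1.
- by move=> a w _; rewrite mule_ge0 ?lee_fin.
rewrite mulr_sumr -sumEFin; apply: eq_bigr => a _.
rewrite ge0_integralZl_EFin //; last first.
  apply/measurable_EFinP; exact: measurable_indic (pattern_law a).1.
rewrite integral_indic //; last exact: (pattern_law a).1.
by rewrite setIT [X in (_ * X)%E](pattern_law a).2 -EFinM mulrC.
Qed.

Lemma measurable_pattern (G : {ffun 'I_q -> bool} -> R) :
  measurable_fun setT (fun w => G (pattern w)).
Proof.
have -> : (fun w => G (pattern w)) =
    (fun w => \sum_a G a * \1_(pattern @^-1` [set a]) w).
  apply/funext => w; rewrite (bigD1 (pattern w)) //= big1 ?addr0.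
    by rewrite indicE mem_set // mulr1.
  by move=> a aw; rewrite indicE memNset ?mulr0 //= => E; rewrite E eqxx in aw.
apply: measurable_sum => a; apply: measurable_funM => //.
exact: measurable_indic (pattern_law a).1.
Qed.

End Pattern.

(** * Networks on augmented views: agreement on the support and inactive neurons *)

Section Networks.
Context {s : nat} (hsd : (s <= d)%N).
Let x := augment s xb tau.
Let xp := augment s xb tau'.

Lemma measurable_augment (t : 'I_d -> T -> R) j :
  (forall l, measurable_fun setT (t l)) ->
  measurable_fun setT (fun w => augment s xb t w j 0).
Proof.
move=> mt; rewrite (_ : (fun w => _) =
  if (j < s)%N then xb j else (fun w => t j w * xb j w)); last first.
  by apply/funext => w; rewrite mxE; case: ifP.
case: ifP => _; first exact: measurable_xb.
by apply: measurable_funM => //; exact: measurable_xb.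
Qed.

Lemma measurable_relu_net (k : nat) (U : 'M[R]_(k, d)) (b : 'cV[R]_k)
    (t : 'I_d -> T -> R) i :
  (forall l, measurable_fun setT (t l)) ->
  measurable_fun setT (fun w => relu_net U b (augment s xb t w) i 0).
Proof.
move=> mt; rewrite (_ : (fun w => _) =
  (fun w => \sum_j U i j * augment s xb t w j 0 + b i 0) \max cst 0).
  apply: measurable_maxr => //; apply: measurable_funD => //.
  apply: measurable_sum => j; apply: measurable_funM => //.
  exact: measurable_augment.
by apply/funext => w; rewrite relu_netE.
Qed.

Lemma augment_box (t t' : 'I_d -> T -> R) w j :
  (forall l, (2%:R^-1 <= t l w <= 1) && (2%:R^-1 <= t' l w <= 1)) ->
  `|augment s xb t w j 0 - augment s xb t' w j 0| <= 2.
Proof.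
move=> /(_ j) /andP[/andP[h1 h2] /andP[h3 h4]]; rewrite !mxE.
case: ifP => _; first by rewrite subrr normr0.
by rewrite ler_norml; case: (hxb_val j w) => ->; apply/andP; split; lra.
Qed.

(** The deterministic counterpart of [augment]: for [t] with values in [1/2, 1] these points sweep
    out the support of the data law. *)
Definition support_point (a : 'I_d -> bool) (t : 'I_d -> R) : 'cV[R]_d :=
  \col_j (if (j < s)%N then signb (a j) else t j * signb (a j)).

Lemma augment_near (t0 : 'I_d -> T -> R) a t e w j : 0 <= e ->
  xb j w = signb (a j) -> `|t0 j w - t j| <= e ->
  `|augment s xb t0 w j 0 - support_point a t j 0| <= e.
Proof.
move=> e0 xa te; rewrite !mxE xa; case: ifP => _; first by rewrite subrr normr0.
rewrite -mulrBl normrM [X in _ * X](_ : _ = 1) ?mulr1 //.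
by case: (a j); rewrite /signb ?normrN normr1.
Qed.

(** Almost sure agreement becomes agreement at every pair of support points over the same signs:
    [sample_near] yields a sample where the two views agree and lie close to the two points, and the
    Lipschitz bound carries the equality over. *)
Lemma relu_net_support (k : nat) (U : 'M[R]_(k, d)) (b : 'cV[R]_k) i a t t' :
  {ae P, forall w, relu_net U b (x w) = relu_net U b (xp w)} ->
  (forall j, 2%:R^-1 <= t j <= 1) -> (forall j, 2%:R^-1 <= t' j <= 1) ->
  relu_net U b (support_point a t) i 0 = relu_net U b (support_point a t') i 0.
Proof.
move=> HA ht ht'; apply/eqP; rewrite -subr_eq0 -normr_le0.
apply/ler_addgt0Pl => e e0; rewrite addr0.
pose M := \sum_j `|U i j|.
have M0 : 0 <= M by apply: sumr_ge0.
(* Chosen so that the two Lipschitz errors add up to at most [e]; the [+ 1] covers [M = 0]. *)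
pose e' := e / (2 * (M + 1)).
have e'0 : 0 < e' by rewrite divr_gt0 // mulr_gt0 //; lra.
have [w [Aw Bw]] := sample_near _ a t t' e' HA e'0 ht ht'.
have h1 : `|relu_net U b (x w) i 0 - relu_net U b (support_point a t) i 0| <= M * e'.
  apply: relu_net_lipschitz => j; have [h1 h2 _] := Bw j.
  by apply: augment_near => //; exact: ltW.
have h2 : `|relu_net U b (xp w) i 0 - relu_net U b (support_point a t') i 0| <= M * e'.
  apply: relu_net_lipschitz => j; have [h2 _ h3] := Bw j.
  by apply: augment_near => //; exact: ltW.
have Me : 2 * (M * e') <= e.
  have -> : 2 * (M * e') = e * (M / (M + 1)) by rewrite /e'; field; lra.
  by rewrite ger_pMr // ler_pdivrMr; lra.
rewrite Aw in h1; move: h1 h2; rewrite !ler_norml => /andP[? ?] /andP[? ?].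
by apply/andP; split; lra.
Qed.

(* A neuron reading an augmented coordinate takes distinct preactivations at two points of one
   fibre of the support, where its outputs agree; hence it is inactive there. *)
Lemma relu_net_dead (k : nat) (U : 'M[R]_(k, d)) (b : 'cV[R]_k) i (j : 'I_d) :
  {ae P, forall w, relu_net U b (x w) = relu_net U b (xp w)} ->
  (s <= j)%N -> U i j != 0 -> {ae P, forall w, relu_net U b (x w) i 0 = 0}.
Proof.
move=> HA sj Uij; apply: (filterS _ tau_box_ae) => w box /=.
pose a (l : 'I_d) := xb l w == 1.
have xa l : xb l w = signb (a l).
  by rewrite /a /signb; case: eqP => // h; case: (hxb_val l w).
pose t l := tau l w.
(* Only multiplier [j] moves: to 1, or to 1/2 if it is already 1. *)
pose t' l := if l == j then (if t j == 1 then 2%:R^-1 else 1) else t l.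
have ht l : 2%:R^-1 <= t l <= 1 by have /andP[] := box l.
have ht' l : 2%:R^-1 <= t' l <= 1.
  by rewrite /t'; case: eqP => // _; case: eqP => _; rewrite ?lexx ?(ltW (half_lt1 R)).
have xE : x w = support_point a t by apply/colP => l; rewrite !mxE xa.
have := relu_net_support k U b i a t t' HA ht ht'.
rewrite xE !relu_netE => /relu_eq; apply.
(* The preactivations differ by [U i j * (t j - t' j) * signb (a j)], a product of nonzero
   factors. *)
apply/eqP; rewrite -subr_eq0 opprD addrACA subrr addr0 -sumrB.
rewrite (bigD1 j) //= big1 ?addr0; last first.
  by move=> l lj; rewrite !mxE /t' (negbTE lj) subrr.
rewrite !mxE ltnNge sj /= /t' eqxx -mulrBr -mulrBl !mulf_eq0 (negbTE Uij) /=.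
have -> : (signb (a j) == 0 :> R) = false.
  by case: (a j); rewrite /signb ?oppr_eq0 oner_eq0.
rewrite orbF subr_eq0; case: (eqVneq (t j) 1) => [->|//].
by rewrite gt_eqF // half_lt1.
Qed.

(** * Zero loss in the ReLU class and the exact linear probe *)

Lemma contrastive_loss_ge0 (k : nat) (lam : R) (f : 'cV[R]_d -> 'cV[R]_k) : 0 < lam ->
  0 <= contrastive_loss P x xp lam f.
Proof.
move=> l0; rewrite /contrastive_loss addr_ge0 //.
  by apply: Ereal_ge0 => w; apply: sqnorm_ge0.
by rewrite mulr_ge0 ?(ltW l0) // !sumr_ge0 // => i _; rewrite sumr_ge0 // => j _; rewrite sqr_ge0.
Qed.

Lemma contrastive_loss_eq0 (k : nat) (lam : R) (f : 'cV[R]_d -> 'cV[R]_k) : 0 < lam ->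
  contrastive_loss P x xp lam f <= 0 ->
  Ereal P (fun w => sqnorm (f (x w) - f (xp w))) = 0 /\
  forall i j, Ereal P (fun w => f (x w) i 0 * f (x w) j 0) = (i == j)%:R.
Proof.
rewrite /contrastive_loss => l0.
set A := Ereal P _; set S := \sum_i _ => H.
have A0 : 0 <= A by apply: Ereal_ge0 => w; apply: sqnorm_ge0.
have s0 i j : 0 <= (Ereal P (fun w => f (x w) i 0 * f (x w) j 0) - (i == j)%:R) ^+ 2.
  exact: sqr_ge0.
have S0 : 0 <= S by rewrite sumr_ge0 // => i _; rewrite sumr_ge0.
have lS : 0 <= lam * S by rewrite mulr_ge0 // ltW.
split; first by apply/eqP; rewrite eq_le A0 andbT; lra.
have /eqP : lam * S = 0 by apply/eqP; rewrite eq_le lS andbT; lra.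
rewrite mulf_eq0 gt_eqF //= psumr_eq0; last by move=> i _; rewrite sumr_ge0.
move=> /allP h i j; have := h i (mem_index_enum i).
rewrite /= psumr_eq0 // => /allP /(_ j (mem_index_enum j)) /=.
by rewrite sqrf_eq0 subr_eq0 => /eqP.
Qed.

(** Two views differ by at most 2 in each coordinate almost surely, so the squared gap is bounded
    and its zero expectation is not an artefact of [fine]. *)
Lemma relu_net_agree (k : nat) (U : 'M[R]_(k, d)) (b : 'cV[R]_k) :
  Ereal P (fun w => sqnorm (relu_net U b (x w) - relu_net U b (xp w))) = 0 ->
  {ae P, forall w, relu_net U b (x w) = relu_net U b (xp w)}.
Proof.
move=> E0; pose C := \sum_(i < k) ((\sum_j `|U i j|) * 2) ^+ 2.
have : {ae P, forall w, sqnorm (relu_net U b (x w) - relu_net U b (xp w)) = 0}.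
  apply: (ae_bounded_Ereal_eq0 P _ C _ _ _ E0).
  - rewrite /sqnorm; apply: measurable_sum => i; apply: measurable_funX.
    rewrite (_ : (fun w => _) = (fun w => relu_net U b (x w) i 0) \- (fun w => relu_net U b (xp w) i 0)).
      by apply: measurable_funB; apply: measurable_relu_net; [exact: measurable_tau|exact: measurable_tau'].
    by apply/funext => w; rewrite /= [LHS]mxE [X in _ + X]mxE.
  - by move=> w; apply: sqnorm_ge0.
  apply: (filterS _ tau_box_ae) => w box /=; apply: ler_sum => i _.
  rewrite -real_normK ?num_real // lerXn2r ?nnegrE ?mulr_ge0 ?sumr_ge0 //.
  rewrite [X in `|X|](_ : _ = relu_net U b (x w) i 0 - relu_net U b (xp w) i 0); last by rewrite [LHS]mxE [X in _ + X]mxE.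
  by apply: relu_net_lipschitz => j; apply: augment_box.
apply: filterS => w /= /eqP; rewrite psumr_eq0 => [/allP h|i _]; last exact: sqr_ge0.
apply/colP => i; have := h i (mem_index_enum i).
by rewrite /= sqrf_eq0 !mxE subr_eq0 => /eqP.
Qed.

Lemma relu_net_zero_loss (lam : R) : exists (U : 'M[R]_(2 ^ s, d)) (b : 'cV[R]_(2 ^ s)),
  contrastive_loss P x xp lam (relu_net U b) = 0.
Proof.
(* Each detector fires with probability [2 ^ -s], so height [c] gives it second moment 1. *)
pose c : R := Num.sqrt (2 ^+ s).
have c0 : 0 <= c by exact: sqrtr_ge0.
pose pat := @sign_pattern s (2 ^ s) (leqnn _).
pose U : 'M[R]_(2 ^ s, d) := \matrix_(i, j)
  (if insub (val j) : option 'I_s is Some l then c * signb (pat i l) else 0).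
(* The inner product of two patterns is [s] if they coincide and at most [s - 1] otherwise; this
   bias leaves [c] in the first case and a nonpositive value in the second. *)
pose b : 'cV[R]_(2 ^ s) := const_mx (- (c * (s%:R - 1))).
have UE (t : 'I_d -> T -> R) i w : relu_net U b (augment s xb t w) i 0 =
    c * (pat i == pattern hsd w)%:R.
  rewrite relu_netE (sum_ord_narrow _ s d hsd) => [|j sj]; last first.
    by rewrite mxE insubF ?mul0r //; apply/negbTE; rewrite -leqNgt.
  rewrite (eq_bigr (fun l => c * (signb (pat i l) * signb (pattern hsd w l)))); last first.
    move=> l _; rewrite !mxE /= ltn_ord xb_pattern //.
    case: insubP => [l' _ /val_inj ->|]; last by rewrite /= ltn_ord.
    by rewrite mulrA.
  rewrite -mulr_sumr !mxE -mulrBr /relu; case: eqP => [->|/eqP ne].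
    rewrite (eq_bigr (fun=> 1)) => [|l _]; last exact: signb_sqr.
    rewrite sumr_const card_ord (_ : _ - _ = 1); last by ring.
    by rewrite mulr1; apply/max_idPl.
  rewrite mulr0; apply/max_idPr; rewrite mulr_ge0_le0 // subr_le0.
  exact: sum_signb_lt.
exists U, b; rewrite /contrastive_loss.
have agree w : relu_net U b (x w) = relu_net U b (xp w) by apply/colP => i; rewrite !UE.
rewrite (_ : Ereal P _ = 0) ?add0r; last first.
  under [X in Ereal P X]eq_fun do rewrite agree subrr sqnorm0.
  by rewrite /Ereal expectation_cst.
rewrite big1 ?mulr0 // => i _; rewrite big1 // => j _.
under [X in Ereal P X]eq_fun do rewrite !UE.
rewrite /Ereal (expectation_pattern hsd (fun a => (c * (pat i == a)%:R) * (c * (pat j == a)%:R))).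
  by rewrite /= sum_indicator_orthogonal subrr expr0n.
by move=> a; rewrite !mulr_ge0.
Qed.

(** A representative of the fibre over [a]. The zeros in the augmented coordinates do not affect its
    label, which depends on the first [s] coordinates only. *)
Definition pattern_point (a : {ffun 'I_s -> bool}) : 'cV[R]_d :=
  \col_j (if insub (val j) : option 'I_s is Some l then signb (a l) else 0).

Lemma label_pattern (m : nat) (y : 'cV[R]_d -> 'I_m) (t : 'I_d -> T -> R) w :
  (forall z z' : 'cV[R]_d, (forall j : 'I_d, (j < s)%N -> z j 0 = z' j 0) -> y z = y z') ->
  y (augment s xb t w) = y (pattern_point (pattern hsd w)).
Proof.
apply=> j js; rewrite !mxE js; case: insubP => [l _ lj|]; last by rewrite js.
by rewrite -xb_pattern //; congr (xb _ w); apply: val_inj.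
Qed.

Lemma relu_net_linear_probe (m : nat) (y : 'cV[R]_d -> 'I_m) (lam : R)
    (U : 'M[R]_(2 ^ s, d)) (b : 'cV[R]_(2 ^ s)) :
  (forall z z' : 'cV[R]_d, (forall j : 'I_d, (j < s)%N -> z j 0 = z' j 0) -> y z = y z') ->
  0 < lam -> contrastive_loss P x xp lam (relu_net U b) <= 0 ->
  exists W : 'M[R]_(m, 2 ^ s), downstream_error P x y W (relu_net U b) = 0%E.
Proof.
move=> hy lam0 /(contrastive_loss_eq0 _ _ _ lam0)[/relu_net_agree HA Eij].
have U0 i (j : 'I_d) : (s <= j)%N -> U i j = 0.
  move=> sj; apply/eqP; apply: contraT => Uij.
  have dead := relu_net_dead _ U b i j HA sj Uij.
  have mf : measurable_fun setT (fun w => relu_net U b (x w) i 0).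
    by apply: measurable_relu_net; exact: measurable_tau.
  have := Eij i i; rewrite eqxx (eq_Ereal_ae P _ (cst 0)).
  - by rewrite /Ereal expectation_cst /= => /eqP; rewrite eq_sym oner_eq0.
  - exact: measurable_funM.
  - exact: measurable_cst.
  - by apply: (filterS _ dead) => w /= ->; rewrite mul0r.
pose F i (a : {ffun 'I_s -> bool}) :=
  relu (\sum_l U i (widen_ord hsd l) * signb (a l) + b i 0).
have FE w i : relu_net U b (x w) i 0 = F i (pattern hsd w).
  rewrite relu_netE (sum_ord_narrow _ s d hsd) => [|j sj]; last by rewrite U0 ?mul0r.
  congr (relu (_ + _)); apply: eq_bigr => l _.
  by rewrite mxE /= ltn_ord xb_pattern.
have F0 i a : 0 <= F i a by rewrite /F /relu le_max lexx orbT.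
pose pat := @sign_pattern s (2 ^ s) (leqnn _).
pose M : 'M[R]_(2 ^ s) := \matrix_(i, l) F i (pat l).
(* The second moment is the average of [F i a * F j a] over the [2 ^ s] patterns, that is [M *m M^T]
   divided by [2 ^ s]. *)
have MM : M *m M^T = (2 ^+ s)%:M.
  apply/matrixP => i j; rewrite mxE [RHS]mxE -[RHS]mulr_natr -Eij.
  under [X in Ereal P X]eq_fun do rewrite !FE.
  rewrite /Ereal (expectation_pattern hsd (fun a => F i a * F j a)) /= => [|a]; last exact: mulr_ge0.
  rewrite mulVKf ?expf_neq0 ?pnatr_eq0 // sum_sign_pattern.
  by apply: eq_bigr => l _; rewrite !mxE.
have Mu : M \in unitmx.
  have : (2 ^+ s)%:M \in @unitmx R (2 ^ s).
    by rewrite unitmxE det_scalar unitfE !expf_neq0 // pnatr_eq0.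
  by rewrite -MM unitmx_mul => /andP[].
pose Y : 'M[R]_(m, 2 ^ s) := \matrix_(i, l) (i == y (pattern_point (pat l)))%:R.
(* Column [l] of [M] is the network output on pattern [l], and column [l] of [Y] is the one-hot
   label there. *)
exists (Y *m invmx M); rewrite /downstream_error.
have E0 w : sqnorm (Y *m invmx M *m relu_net U b (x w) - delta_mx (y (x w)) (ord0 : 'I_1)) = 0.
  (* Surjectivity of [pat] by counting: the indicator of a missed pattern would have a positive sum
     over patterns and sum 0 over indices. *)
  have [l pl] : exists l, pat l = pattern hsd w.
    have := sum_sign_pattern nat s (fun a => (a == pattern hsd w) : nat).
    rewrite (bigD1 (pattern hsd w)) //= eqxx => h.
    suff /existsP[l /eqP pl] : [exists l, pat l == pattern hsd w] by exists l.
    apply: contraT; rewrite negb_exists => /forallP h'.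
    by move: h; rewrite [RHS]big1 // => l _; rewrite -/pat (negbTE (h' l)).
  have -> : relu_net U b (x w) = col l M.
    by apply/colP => i; rewrite !mxE pl -FE relu_netE.
  rewrite colE -!mulmxA (mulmxA (invmx M)) mulVmx // mul1mx -colE.
  rewrite (_ : _ - _ = 0) ?sqnorm0 //; apply/eqP; rewrite subr_eq0; apply/eqP.
  by apply/colP => i; rewrite !mxE andbT pl -(label_pattern m y tau w hy).
under [X in expectation P X]eq_fun do rewrite E0.
by rewrite expectation_cst.
Qed.

(** * The sign code: zero loss with a poor linear probe *)

Definition sign_code {k : nat} (h : (k <= 2 ^ d)%N) (z : 'cV[R]_d) : 'cV[R]_k :=
  \col_i (Num.sqrt (2 ^+ d) * (sign_pattern h i == [ffun j => 0 < z j 0])%:R).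

Lemma measurable_sign_code (k : nat) (h : (k <= 2 ^ d)%N) (t : 'I_d -> T -> R) i :
  (forall l, measurable_fun setT (t l)) ->
  measurable_fun setT (fun w => sign_code h (augment s xb t w) i 0).
Proof.
move=> mt; pose E := \bigcap_(j in [set: 'I_d])
  ((fun w => augment s xb t w j 0) @^-1`
    (if sign_pattern h i j then `]0, +oo[%classic else `]-oo, 0]%classic)).
have mE : measurable E.
  apply: fin_bigcap_measurable; first exact: finite_finset.
  move=> j _; rewrite -[X in measurable X]setTI.
  by apply: (measurable_augment t j mt) => //; case: ifP => _; exact: measurable_itv.
rewrite (_ : (fun w => _) = (fun w => Num.sqrt (2 ^+ d) * \1_E w)).
  by apply: measurable_funM => //; exact: measurable_indic.
apply/funext => w; rewrite mxE indicE; congr (_ * _%:R); congr nat_of_bool; apply/eqP/idP.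
  move=> spE; apply/mem_set => j _; rewrite /= spE ffunE.
  by case: ltP => hj; rewrite /= in_itv /= ?hj.
move=> /set_mem wE; apply/ffunP => j; have := wE j I; rewrite /= [RHS]ffunE.
case: (sign_pattern h i j); rewrite /= in_itv /=; first by rewrite andbT => ->.
by rewrite leNgt => /negbTE ->.
Qed.

Lemma sign_code_box (k : nat) (h : (k <= 2 ^ d)%N) (t : 'I_d -> T -> R) w i :
  (forall l, 2%:R^-1 <= t l w) ->
  sign_code h (augment s xb t w) i 0 =
  Num.sqrt (2 ^+ d) * (sign_pattern h i == pattern (leqnn d) w)%:R.
Proof.
move=> ht; rewrite mxE; congr (_ * (_ == _)%:R); apply/ffunP => j.
have t0 : 0 < t j w by apply: lt_le_trans (ht j); rewrite invr_gt0.
rewrite !ffunE mxE (_ : widen_ord (leqnn d) j = j); last exact: val_inj.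
have N1 : (-1 == 1 :> R) = false by apply: lt_eqF; lra.
case: (hxb_val j w) => ->; rewrite ?eqxx ?N1.
  by case: ifP => _; rewrite ?mulr1 ?ltr01.
by case: ifP => _; rewrite ?mulrN1 ?oppr_gt0; apply: le_gtF; lra.
Qed.

Lemma sign_code_agree (k : nat) (h : (k <= 2 ^ d)%N) :
  {ae P, forall w, sign_code h (x w) = sign_code h (xp w)}.
Proof.
apply: (filterS _ tau_box_ae) => w box /=; apply/colP => i.
by rewrite !sign_code_box // => l; have /andP[/andP[? _] /andP[? _]] := box l.
Qed.

Lemma sign_code_zero_loss (k : nat) (h : (k <= 2 ^ d)%N) (lam : R) :
  contrastive_loss P x xp lam (sign_code h) = 0.
Proof.
have mx i : measurable_fun setT (fun w => sign_code h (x w) i 0).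
  by apply: measurable_sign_code; exact: measurable_tau.
have mxp i : measurable_fun setT (fun w => sign_code h (xp w) i 0).
  by apply: measurable_sign_code; exact: measurable_tau'.
rewrite /contrastive_loss (eq_Ereal_ae P _ (cst 0)); first last.
- by apply: (filterS _ (sign_code_agree _ h)) => w /= ->; rewrite subrr sqnorm0.
- exact: measurable_cst.
- rewrite /sqnorm; apply: measurable_sum => i; apply: measurable_funX.
  rewrite (_ : (fun w => _) = (fun w => sign_code h (x w) i 0) \- (fun w => sign_code h (xp w) i 0)).
    exact: measurable_funB.
  by apply/funext => w; rewrite /= [LHS]mxE [X in _ + X]mxE.
rewrite {1}/Ereal expectation_cst /= add0r.
rewrite big1 ?mulr0 // => i _; rewrite big1 // => j _.
pose G a : R := (Num.sqrt (2 ^+ d) * (sign_pattern h i == a)%:R) *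
  (Num.sqrt (2 ^+ d) * (sign_pattern h j == a)%:R).
rewrite (eq_Ereal_ae P _ (fun w => G (pattern (leqnn d) w))); first last.
- apply: (filterS _ tau_box_ae) => w box /=.
  by rewrite !sign_code_box // => l; have /andP[/andP[? _] _] := box l.
- exact: measurable_pattern.
- exact: measurable_funM.
rewrite /Ereal expectation_pattern => [|a]; last by rewrite /G !mulr_ge0 ?sqrtr_ge0.
by rewrite /= sum_indicator_orthogonal subrr expr0n.
Qed.

Lemma sign_code_admissible (k : nat) (h : (k <= 2 ^ d)%N) : admissible P x xp (sign_code h).
Proof.
move=> i.
have mx : measurable_fun setT (fun w => sign_code h (x w) i 0).
  by apply: measurable_sign_code; exact: measurable_tau.
have mxp : measurable_fun setT (fun w => sign_code h (xp w) i 0).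
  by apply: measurable_sign_code; exact: measurable_tau'.
have int (g : T -> R) (z : T -> 'cV[R]_d) : (g = fun w => sign_code h (z w) i 0) ->
    measurable_fun setT g -> P.-integrable setT (fun w => (g w ^+ 2)%:E).
  move=> -> mg.
  have int_cst := finite_measure_integrable_cst P (2 ^+ d : R) (@measurableT _ T).
  apply: (le_integrable measurableT _ _ int_cst).
    by apply/measurable_EFinP; exact: measurable_funX.
  move=> w _ /=; rewrite lee_fin !ger0_norm ?sqr_ge0 ?exprn_ge0 //.
  rewrite mxE exprMn sqr_sqrtr ?exprn_ge0 // ger_pMr ?exprn_gt0 //.
  by case: eqP; rewrite ?expr1n ?expr0n.
by split=> //; split=> //; split; apply: int.
Qed.

Lemma sign_code_error (k m : nat) (h : (k <= 2 ^ d)%N) (y : 'cV[R]_d -> 'I_m) (W : 'M[R]_(m, k)) :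
  (forall z z' : 'cV[R]_d, (forall j : 'I_d, (j < s)%N -> z j 0 = z' j 0) -> y z = y z') ->
  (((2 ^+ d)^-1 * ((2 ^ d)%:R - k%:R))%:E <= downstream_error P x y W (sign_code h))%E.
Proof.
move=> hy.
pose missed (a : {ffun 'I_d -> bool}) : R := (a \notin codom (sign_pattern h))%:R.
have -> : (2 ^ d)%:R - k%:R = \sum_a missed a.
  have cardM : (k + #|[predC codom (sign_pattern h)]| = 2 ^ d)%N.
    have := cardC (mem (codom (sign_pattern h))).
    by rewrite (card_codom (sign_pattern_inj h)) card_ord card_sign_patterns.
  rewrite -cardM natrD addrAC subrr add0r -sum1_card big_mkcond /= natr_sum.
  by apply: eq_bigr => a _; rewrite /missed inE; case: (_ \in _).
rewrite -(expectation_pattern (leqnn d)) => [|a]; last by rewrite /missed ler0n.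
rewrite /downstream_error unlock; apply: ae_ge0_le_integral => //.
- by move=> w _; rewrite lee_fin ler0n.
- by apply/measurable_EFinP; exact: measurable_pattern.
- by move=> w _; rewrite lee_fin sqnorm_ge0.
- apply/measurable_EFinP; rewrite /sqnorm; apply: measurable_sum => i; apply: measurable_funX.
  rewrite (_ : (fun w => _) = (fun w => \sum_j W i j * sign_code h (x w) j 0) \-
      (fun w => (i == y (pattern_point (pattern hsd w)))%:R)).
    apply: measurable_funB.
      apply: measurable_sum => j; apply: measurable_funM => //.
      by apply: measurable_sign_code; exact: measurable_tau.
    exact: (measurable_pattern hsd (fun a => (i == y (pattern_point a))%:R)).
  apply/funext => w; rewrite /= [LHS]mxE [X in _ + X]mxE; congr (_ - _); rewrite mxE //.
  by rewrite andbT (label_pattern m y tau w hy).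
- apply: (filterS _ tau_box_ae) => w box _ /=; rewrite lee_fin.
  have [ha|ha] := boolP (pattern (leqnn d) w \in codom (sign_pattern h)).
    by rewrite /missed ha sqnorm_ge0.
  rewrite /missed ha.
  have -> : sign_code h (x w) = 0.
    apply/colP => i; rewrite sign_code_box; last first.
      by move=> l; have /andP[/andP[? _] _] := box l.
    rewrite mxE; case: eqP => [E|]; last by rewrite mulr0.
    by rewrite -E codom_f in ha.
  rewrite mulmx0 sub0r /sqnorm (bigD1 (y (x w))) //= !mxE !eqxx sqrrN expr1n lerDl.
  by rewrite sumr_ge0 // => i _; exact: sqr_ge0.
Qed.

End Networks.

End Sampling.

Theorem theorem5 (R : realType) (d s m : nat) (hs1 : (1 <= s)%N) (hsd : (s <= d)%N)
    (y : 'cV[R]_d -> 'I_m)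
    (hy : forall z z' : 'cV[R]_d,
        (forall j : 'I_d, (j < s)%N -> z j 0 = z' j 0) -> y z = y z')
    (dT : measure_display) (T : measurableType dT) (P : probability T R)
    (xb tau tau' : 'I_d -> T -> R)
    (hxb_val : forall j w, xb j w = 1 \/ xb j w = -1)
    (hxb_law : forall j, P (xb j @^-1` [set 1]) = (2%:R^-1)%:E)
    (htau_law : forall j B, measurable B ->
        P (tau j @^-1` B) = uniform_prob (half_lt1 R) B)
    (htau'_law : forall j B, measurable B ->
        P (tau' j @^-1` B) = uniform_prob (half_lt1 R) B)
    (hindep : mutually_independent P
        (fun i : ('I_d + ('I_d + 'I_d))%type =>
           match i with
           | inl j => xb j
           | inr (inl j) => tau j
           | inr (inr j) => tau' j
           end))
    (lam : R) (hlam : 0 < lam) :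
  let x := augment s xb tau in
  let xp := augment s xb tau' in
  (* (1) ReLU class with k = 2^s *)
  (forall (U : 'M[R]_(2 ^ s, d)) (b : 'cV[R]_(2 ^ s)),
     (forall (U' : 'M[R]_(2 ^ s, d)) (b' : 'cV[R]_(2 ^ s)),
        contrastive_loss P x xp lam (relu_net U b)
        <= contrastive_loss P x xp lam (relu_net U' b')) ->
     exists W : 'M[R]_(m, 2 ^ s),
       downstream_error P x y W (relu_net U b) = 0%E)
  /\
  (* (2) universal class *)
  (forall k : nat, (k <= 2 ^ (d - s))%N ->
     exists f : 'cV[R]_d -> 'cV[R]_k,
       admissible P x xp f /\
       (forall g : 'cV[R]_d -> 'cV[R]_k, admissible P x xp g ->
          contrastive_loss P x xp lam f <= contrastive_loss P x xp lam g) /\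
       (forall W : 'M[R]_(m, k),
          ((2%:R^-1)%:E <= downstream_error P x y W f)%E)).
Proof.
move=> x xp; split=> [U b Umin|k hk].
  have [U0 [b0 loss0]] :=
    relu_net_zero_loss hxb_val hxb_law hindep hsd lam.
  apply: (relu_net_linear_probe hxb_val hxb_law htau_law htau'_law hindep hsd m y lam U b hy hlam).
  by rewrite -loss0.
have hkd : (k <= 2 ^ d)%N by rewrite (leq_trans hk) // leq_exp2l // leq_subr.
exists (sign_code hkd); split; last split.
- exact: (sign_code_admissible hindep).
- move=> g _.
  rewrite (sign_code_zero_loss hxb_val hxb_law htau_law htau'_law hindep k hkd lam).
  exact: contrastive_loss_ge0.
move=> W; apply: le_trans
  (sign_code_error hxb_val hxb_law htau_law htau'_law hindep hsd k m hkd y W hy).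
have k2 : (k * 2 <= 2 ^ d)%N.
  apply: (@leq_trans (2 ^ (d - s).+1)%N); first by rewrite expnSr leq_mul2r.
  by rewrite leq_exp2l //; lia.
have k2R : k%:R * 2 <= 2 ^+ d :> R by rewrite -natrM -natrX ler_nat.
rewrite lee_fin natrX ler_pdivlMl ?exprn_gt0 //; lra.
Qed.
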